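(* Let $n\ge 1$ and let $\Bbbk$ be a field. Then for every $X\in P_1([n])$ the $\Bbbk\mathrm{OD}_n$-module $\Bbbk L_X$ is a projective module, and $$\Bbbk\mathrm{OD}_n\simeq\bigoplus_{X\in P_1([n])}\Bbbk L_X$$ is an isomorphism of $\Bbbk\mathrm{OD}_n$-modules.
   Context: $[n]=\{1,\dots,n\}$, and $\mathrm{OD}_n$ is the monoid (under composition, $(fg)(x)=f(g(x))$) of all functions $f:[n]\to[n]$ that are order-preserving or order-reversing; $\Bbbk\mathrm{OD}_n$ is its monoid algebra, regarded in the isomorphism as a left module over itself. $P_1([n])$ is the set of subsets $X\subseteq[n]$ with $1\in X$. The kernel classes (fibres) of $f\in\mathrm{OD}_n$ are intervals; the kernel set of $f$ is the set of minimal elements of its kernel classes, which belongs to $P_1([n])$. For $X\in P_1([n])$, $L_X$ is the set of all $f\in\mathrm{OD}_n$ with kernel set $X$ (an $\mathcal{L}$-class of $\mathrm{OD}_n$), and $\Bbbk L_X$ (the induced left Schützenberger module) is the $\Bbbk$-vector space with basis $L_X$ and left $\Bbbk\mathrm{OD}_n$-module structure determined by $s\bullet x=sx$ if $sx\in L_X$ and $s\bullet x=0$ otherwise ($s\in\mathrm{OD}_n$, $x\in L_X$). *)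

(* Defs.v *)
From HB Require Import structures.
From mathcomp Require Import all_boot all_order all_algebra.

Set Implicit Arguments.
Unset Strict Implicit.
Unset Printing Implicit Defensive.

Import GRing.Theory.
Local Open Scope ring_scope.

Definition projective (R : pzRingType) (P : lmodType R) : Prop :=
  forall (M N : lmodType R) (g : {linear M -> N}) (h : {linear P -> N}),
    (forall y : N, exists x : M, g x = y) ->
    exists h' : {linear P -> M}, forall x : P, g (h' x) = h x.

Definition lmod_iso (R : pzRingType) (M N : lmodType R) : Prop :=
  exists f : {linear M -> N}, bijective f.

(* The index type is finite, so the direct sum is carried by the product. *)
Definition dsum (R : pzRingType) (I : finType) (M : I -> lmodType R) :=
  {dffun forall i : I, M i}.

Section DirectSum.
Variables (R : pzRingType) (I : finType) (M : I -> lmodType R).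
Implicit Types u v w : dsum M.

HB.instance Definition _ := Choice.on (dsum M).

Definition dsum0 : dsum M := [ffun i => 0].
Definition dsum_add u v : dsum M := [ffun i => u i + v i].
Definition dsum_opp u : dsum M := [ffun i => - u i].
Definition dsum_scale (a : R) u : dsum M := [ffun i => a *: u i].

Fact dsum_addA : associative dsum_add.
Proof. by move=> u v w; apply/ffunP=> i; rewrite !ffunE addrA. Qed.
Fact dsum_addC : commutative dsum_add.
Proof. by move=> u v; apply/ffunP=> i; rewrite !ffunE addrC. Qed.
Fact dsum_add0 : left_id dsum0 dsum_add.
Proof. by move=> u; apply/ffunP=> i; rewrite !ffunE add0r. Qed.
Fact dsum_addN : left_inverse dsum0 dsum_opp dsum_add.
Proof. by move=> u; apply/ffunP=> i; rewrite !ffunE addNr. Qed.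

HB.instance Definition _ :=
  GRing.isZmodule.Build (dsum M) dsum_addA dsum_addC dsum_add0 dsum_addN.

Fact dsum_scaleA a b u : dsum_scale a (dsum_scale b u) = dsum_scale (a * b) u.
Proof. by apply/ffunP=> i; rewrite !ffunE scalerA. Qed.
Fact dsum_scale1 : left_id 1 dsum_scale.
Proof. by move=> u; apply/ffunP=> i; rewrite !ffunE scale1r. Qed.
Fact dsum_scaleDr : right_distributive dsum_scale +%R.
Proof. by move=> a u v; apply/ffunP=> i; rewrite !ffunE scalerDr. Qed.
Fact dsum_scaleDl u : {morph dsum_scale^~ u : a b / a + b}.
Proof. by move=> a b; apply/ffunP=> i; rewrite !ffunE scalerDl. Qed.

HB.instance Definition _ := GRing.Zmodule_isLmodule.Build R (dsum M)
  dsum_scaleA dsum_scale1 dsum_scaleDr dsum_scaleDl.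

End DirectSum.

(* [n] is 'I_n, so the element 1 of [n] is the ordinal of value 0. *)
Section Monoid.
Variable n : nat.
Implicit Types f g : {ffun 'I_n -> 'I_n}.

Definition order_preserving f : bool :=
  [forall x : 'I_n, forall y : 'I_n, (x <= y)%N ==> (f x <= f y)%N].
Definition order_reversing f : bool :=
  [forall x : 'I_n, forall y : 'I_n, (x <= y)%N ==> (f y <= f x)%N].

Lemma order_preservingP f :
  reflect (forall x y : 'I_n, (x <= y)%N -> (f x <= f y)%N) (order_preserving f).
Proof.
apply: (iffP 'forall_forallP) => H x y; first exact/implyP/H.
exact/implyP/H.
Qed.

Lemma order_reversingP f :
  reflect (forall x y : 'I_n, (x <= y)%N -> (f y <= f x)%N) (order_reversing f).
Proof.
apply: (iffP 'forall_forallP) => H x y; first exact/implyP/H.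
exact/implyP/H.
Qed.

Definition OD :=
  {f : {ffun 'I_n -> 'I_n} | order_preserving f || order_reversing f}.

HB.instance Definition _ := SubFinite.on OD.

Fact OD_one_subproof :
  order_preserving [ffun x => x] || order_reversing [ffun x => x].
Proof. by apply/orP; left; apply/order_preservingP=> x y; rewrite !ffunE. Qed.

Fact OD_mul_subproof (f g : OD) :
  order_preserving [ffun x => val f (val g x)]
  || order_reversing [ffun x => val f (val g x)].
Proof.
case: f g => [f /= /orP hf] [g /= /orP hg]; apply/orP.
case: hf => [/order_preservingP|/order_reversingP] hf;
  case: hg => [/order_preservingP|/order_reversingP] hg;
  [left|right|right|left];
  (apply/order_preservingP || apply/order_reversingP) => x y xy;
  by rewrite !ffunE; apply: hf; apply: hg.
Qed.

Definition OD_one : OD := Sub [ffun x => x] OD_one_subproof.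
Definition OD_mul (f g : OD) : OD := Sub [ffun x => val f (val g x)] (OD_mul_subproof f g).

Fact OD_mulA : associative OD_mul.
Proof. by move=> f g h; apply/val_inj/ffunP=> x; rewrite !ffunE. Qed.
Fact OD_mul1g : left_id OD_one OD_mul.
Proof. by move=> f; apply/val_inj/ffunP=> x; rewrite !ffunE. Qed.
Fact OD_mulg1 : right_id OD_one OD_mul.
Proof. by move=> f; apply/val_inj/ffunP=> x; rewrite !ffunE. Qed.

HB.instance Definition _ := isMonoid.Build OD OD_mulA OD_mul1g OD_mulg1.

Lemma OD_mulE (s t : OD) x : val (s * t)%g x = val s (val t x).
Proof. by rewrite ffunE. Qed.

Definition kernel_set (f : OD) : {set 'I_n} :=
  [set x : 'I_n | [forall y : 'I_n, (val f y == val f x) ==> (x <= y)%N]].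

Definition P1 : {set {set 'I_n}} :=
  [set X : {set 'I_n} | [exists x : 'I_n in X, val x == 0%N]].

Definition L (X : {set 'I_n}) := {f : OD | kernel_set f == X}.

HB.instance Definition _ X := SubFinite.on (L X).

Lemma kernel_set_P1 (f : OD) : (0 < n)%N -> kernel_set f \in P1.
Proof.
move=> n0; rewrite inE; apply/exists_inP; exists (Ordinal n0) => //.
by rewrite inE; apply/forallP=> y; apply/implyP.
Qed.

Lemma kernel_set_mul (s t : OD) : kernel_set (s * t)%g \subset kernel_set t.
Proof.
apply/subsetP=> x; rewrite !inE => /forallP H; apply/forallP=> y.
apply/implyP=> /eqP e; apply: (implyP (H y)).
by rewrite !OD_mulE e.
Qed.

Lemma kernel_set_mulW X (s t x : OD) :
  kernel_set x == X -> kernel_set (s * (t * x))%g == X ->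
  kernel_set (t * x)%g == X.
Proof.
move=> /eqP xX /eqP stX; rewrite eqEsubset -{1}xX kernel_set_mul /=.
by rewrite -stX kernel_set_mul.
Qed.

End Monoid.

(* The type {ffun OD n -> k} already carries the pointwise product; the alias
   below is what carries the convolution product. *)
Definition ODalg (k : fieldType) (n : nat) := {ffun OD n -> k}.

Section MonoidAlgebra.
Variables (k : fieldType) (n : nat).
Implicit Types a b c : ODalg k n.

HB.instance Definition _ := GRing.Lmodule.copy (ODalg k n) {ffun OD n -> k^o}.

Definition ODalg_basis (s : OD n) : ODalg k n := [ffun t => (t == s)%:R].

Definition ODalg_mul a b : ODalg k n :=
  \sum_s \sum_t (a s * b t) *: ODalg_basis (s * t)%g.

Lemma ODalg_mulE a b u :
  ODalg_mul a b u = \sum_s \sum_t a s * b t * (u == s * t)%g%:R.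
Proof.
rewrite /ODalg_mul sum_ffunE; apply: eq_bigr => s _.
by rewrite sum_ffunE; apply: eq_bigr => t _; rewrite !ffunE.
Qed.

Lemma ODalg_mul_sum a b (G : OD n -> k) :
  \sum_u ODalg_mul a b u * G u = \sum_s \sum_t a s * b t * G (s * t)%g.
Proof.
under eq_bigr do rewrite ODalg_mulE mulr_suml.
rewrite exchange_big /=; apply: eq_bigr => s _.
under eq_bigr do rewrite mulr_suml.
rewrite exchange_big /=; apply: eq_bigr => t _.
rewrite (bigD1 (s * t)%g) //= eqxx mulr1 big1 ?addr0 // => u /negbTE->.
by rewrite mulr0 mul0r.
Qed.

Lemma ODalg_basis_sum s (G : OD n -> k) : \sum_u ODalg_basis s u * G u = G s.
Proof.
rewrite (bigD1 s) //= ffunE eqxx mul1r big1 ?addr0 // => u /negbTE us.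
by rewrite ffunE us mul0r.
Qed.

Fact ODalg_mulA : associative (@ODalg_mul).
Proof.
move=> a b c; apply/ffunP=> w; rewrite !ODalg_mulE.
under [RHS]eq_bigr => u _.
  under eq_bigr do rewrite -mulrA.
  rewrite -mulr_sumr; over.
rewrite ODalg_mul_sum; apply: eq_bigr => s _.
under eq_bigr do rewrite -mulrA mulrCA.
rewrite ODalg_mul_sum; apply: eq_bigr => t _.
rewrite mulr_sumr; apply: eq_bigr => r _.
by rewrite mulgA !mulrA [b t * c r * _]mulrC !mulrA.
Qed.

Fact ODalg_mul1 : left_id (ODalg_basis 1%g) ODalg_mul.
Proof.
move=> a; apply/ffunP=> w; rewrite ODalg_mulE.
under eq_bigr => s _.
  under eq_bigr do rewrite -mulrA.
  rewrite -mulr_sumr; over.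
rewrite ODalg_basis_sum (bigD1 w) //= mul1g eqxx mulr1 big1 ?addr0 // => u uw.
by rewrite mul1g eq_sym (negbTE uw) mulr0.
Qed.

Fact ODalg_1mul : right_id (ODalg_basis 1%g) ODalg_mul.
Proof.
move=> a; apply/ffunP=> w; rewrite ODalg_mulE.
under eq_bigr => s _.
  under eq_bigr do rewrite -mulrA mulrCA.
  rewrite ODalg_basis_sum; over.
rewrite (bigD1 w) //= mulg1 eqxx mulr1 big1 ?addr0 // => u uw.
by rewrite mulg1 eq_sym (negbTE uw) mulr0.
Qed.

Fact ODalg_mulDl : left_distributive (@ODalg_mul) +%R.
Proof.
move=> a b c; apply/ffunP=> w; rewrite [RHS]ffunE !ODalg_mulE -big_split.
apply: eq_bigr => s _; rewrite -big_split; apply: eq_bigr => t _ /=.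
by rewrite ffunE !mulrDl.
Qed.

Fact ODalg_mulDr : right_distributive (@ODalg_mul) +%R.
Proof.
move=> a b c; apply/ffunP=> w; rewrite [RHS]ffunE !ODalg_mulE -big_split.
apply: eq_bigr => s _; rewrite -big_split; apply: eq_bigr => t _ /=.
by rewrite ffunE mulrDr mulrDl.
Qed.

Fact ODalg_one_neq0 : ODalg_basis 1%g != 0.
Proof.
apply/eqP=> /ffunP/(_ 1%g); rewrite !ffunE eqxx => /eqP.
by rewrite oner_eq0.
Qed.

HB.instance Definition _ := GRing.Zmodule_isNzRing.Build (ODalg k n)
  ODalg_mulA ODalg_mul1 ODalg_1mul ODalg_mulDl ODalg_mulDr ODalg_one_neq0.

Fact ODalg_scaleAl (x : k) a b : x *: (a * b) = (x *: a) * b.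
Proof.
apply/ffunP=> w; rewrite [LHS]ffunE !ODalg_mulE scaler_sumr.
apply: eq_bigr => s _; rewrite scaler_sumr; apply: eq_bigr => t _.
by rewrite ffunE /GRing.scale /= !mulrA.
Qed.

Fact ODalg_scaleAr (x : k) a b : x *: (a * b) = a * (x *: b).
Proof.
apply/ffunP=> w; rewrite [LHS]ffunE !ODalg_mulE scaler_sumr.
apply: eq_bigr => s _; rewrite scaler_sumr; apply: eq_bigr => t _.
by rewrite ffunE /GRing.scale /= !mulrA [x * a s]mulrC.
Qed.

HB.instance Definition _ :=
  GRing.Lmodule_isLalgebra.Build k (ODalg k n) ODalg_scaleAl.
HB.instance Definition _ :=
  GRing.Lalgebra_isAlgebra.Build k (ODalg k n) ODalg_scaleAr.

Lemma ODalg_basisM s t : ODalg_basis s * ODalg_basis t = ODalg_basis (s * t)%g.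
Proof.
apply/ffunP=> w; rewrite [LHS]ODalg_mulE.
under eq_bigr => u _.
  under eq_bigr do rewrite -mulrA.
  rewrite -mulr_sumr; over.
by rewrite !ODalg_basis_sum !ffunE.
Qed.

End MonoidAlgebra.

(* No k-module structure is declared on kL: in MathComp a type has one
   canonical ring of scalars, and here it is ODalg k n. *)
Definition kL (k : fieldType) (n : nat) (X : {set 'I_n}) := {ffun L X -> k}.

Section Schutzenberger.
Variables (k : fieldType) (n : nat) (X : {set 'I_n}).
Implicit Types (a b : ODalg k n) (u v : kL k X) (s t : OD n) (x y : L X).

HB.instance Definition _ := GRing.Zmodule.on (kL k X).

Definition kL_basis x : kL k X := [ffun y => (y == x)%:R].

Definition bullet s x : kL k X :=
  if insub (s * val x)%g is Some y then kL_basis y else 0.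

Definition kL_act a v : kL k X :=
  \sum_s \sum_x (a s * v x) *: (bullet s x : {ffun L X -> k^o}).

Lemma bulletE s x y : bullet s x y = (val y == s * val x)%g%:R.
Proof.
rewrite /bullet; case: insubP => [z _ zE|]; first by rewrite ffunE -zE.
move=> sxX; rewrite ffunE; case: eqP => // yE.
by rewrite -yE (valP y) in sxX.
Qed.

Lemma kL_actE a v y :
  kL_act a v y = \sum_s \sum_x a s * v x * (val y == s * val x)%g%:R.
Proof.
rewrite /kL_act sum_ffunE; apply: eq_bigr => s _.
by rewrite sum_ffunE; apply: eq_bigr => x _; rewrite ffunE bulletE.
Qed.

Fact kL_actA a b v : kL_act a (kL_act b v) = kL_act (a * b) v.
Proof.
apply/ffunP=> y; rewrite !kL_actE.
under [RHS]eq_bigr => u _.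
  under eq_bigr do rewrite -mulrA.
  rewrite -mulr_sumr; over.
rewrite ODalg_mul_sum; apply: eq_bigr => s _.
under eq_bigr => x _.
  rewrite kL_actE mulr_sumr mulr_suml.
  under eq_bigr do rewrite mulr_sumr mulr_suml.
  over.
rewrite exchange_big /=; apply: eq_bigr => t _.
rewrite exchange_big /= mulr_sumr; apply: eq_bigr => x _.
have [yE|yE] := eqVneq (val y) (s * t * val x)%g; last first.
  rewrite !mulr0 big1 // => z _.
  have [->|_] := eqVneq (val z); last by rewrite mulr0 mulr0 mul0r.
  by rewrite mulgA (negbTE yE) mulr0.
have txX : kernel_set (t * val x)%g == X.
  by apply: (kernel_set_mulW (s := s)); rewrite ?(valP x) // mulgA -yE (valP y).
have [z0 z0E] : exists z0 : L X, val z0 = (t * val x)%g.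
  by exists (Sub (t * val x)%g txX).
rewrite (bigD1 z0) //= z0E eqxx mulgA yE eqxx !mulr1 big1 ?addr0 ?mulrA //.
move=> z zt; case: eqP => [zE|_]; last by rewrite mulr0 mulr0 mul0r.
by case/eqP: zt; exact/val_inj/(etrans zE)/esym.
Qed.

Fact kL_act1 : left_id 1 kL_act.
Proof.
move=> v; apply/ffunP=> y; rewrite kL_actE.
under eq_bigr => s _.
  under eq_bigr do rewrite -mulrA.
  rewrite -mulr_sumr; over.
rewrite [LHS]ODalg_basis_sum (bigD1 y) //= mul1g eqxx mulr1.
rewrite big1 ?addr0 // => x xy.
by rewrite mul1g (inj_eq val_inj) eq_sym (negbTE xy) mulr0.
Qed.

Fact kL_actDr : right_distributive kL_act +%R.
Proof.
move=> a u v; apply/ffunP=> y; rewrite [RHS]ffunE !kL_actE -big_split.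
apply: eq_bigr => s _; rewrite -big_split; apply: eq_bigr => x _ /=.
by rewrite ffunE mulrDr mulrDl.
Qed.

Fact kL_actDl v : {morph kL_act^~ v : a b / a + b}.
Proof.
move=> a b; apply/ffunP=> y; rewrite [RHS]ffunE !kL_actE -big_split.
apply: eq_bigr => s _; rewrite -big_split; apply: eq_bigr => x _ /=.
by rewrite ffunE !mulrDl.
Qed.

HB.instance Definition _ := GRing.Zmodule_isLmodule.Build (ODalg k n) (kL k X)
  kL_actA kL_act1 kL_actDr kL_actDl.

Lemma kL_act_basis s x : ODalg_basis k s *: kL_basis x = bullet s x.
Proof.
apply/ffunP=> y; rewrite [LHS]kL_actE bulletE.
under eq_bigr => t _.
  under eq_bigr do rewrite -mulrA.
  rewrite -mulr_sumr; over.
rewrite ODalg_basis_sum (bigD1 x) //= ffunE eqxx mul1r big1 ?addr0 //.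
by move=> z /negbTE zx; rewrite ffunE zx mul0r.
Qed.

End Schutzenberger.

(* Main.v *)
Require Import Defs.
From HB Require Import structures.
From mathcomp Require Import all_boot all_order all_algebra.

Set Implicit Arguments.
Unset Strict Implicit.
Unset Printing Implicit Defensive.

Import GRing.Theory.
Local Open Scope ring_scope.

(** The isomorphism sends a to the family (a *: floor_X)_X, where floor_X is
    the order-preserving retraction of [n] onto X that rounds down; it lies in
    L_X. Since a map u lies in exactly one L_X, the basis of the direct sum is
    again OD_n, and in these coordinates the coefficient at u of the image of
    s is 1 if u = s floor_(K u) and 0 otherwise, where K u is the kernel set of
    u.

    This matrix is unitriangular. Its diagonal is 1 because every u is constant
    between the minimum of a fibre and any point of this fibre, so that
    u floor_(K u) = u ([mul_floor_kernel]). For the rest, rounding down maps an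
    initial segment of [n] into itself, so u = s floor_(K u) forces
    u([0,y]) to be a subset of s([0,y]) for every y. If all these inclusions
    are equalities, then u and s have the same kernel set, because y is minimal
    in its fibre exactly when the image of the initial segment grows at y; then
    s = s floor_(K s) = u. Hence the sum over y of the sizes of these images is
    larger at s than at u for every nonzero entry off the diagonal
    ([prefix_weight_lt]), and a unitriangular matrix is invertible
    ([unitriangular_bij]).

    Each k L_X is thereby a retract of the regular module, hence projective
    ([projective_retract_regular]). *)

(** * Unitriangular systems *)

(** Solving [a + N a = d], with N the strict part of A, means finding the
    fixed point of [a |-> d - N a]. As N only looks at indices of larger weight,
    each iteration makes the values correct on one more weight level, and after
    more iterations than there are weights the starting point is forgotten. *)
Lemma unitriangular_bij (R : pzRingType) (T : finType) (w : T -> nat)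
    (A : T -> T -> R) :
  (forall u, A u u = 1) ->
  (forall u s, s != u -> A u s != 0 -> (w u < w s)%N) ->
  bijective (fun a : {ffun T -> R} => [ffun u => \sum_s a s * A u s]).
Proof.
move=> A1 Alt.
pose step (d a : {ffun T -> R}) := [ffun u => d u - \sum_(s | s != u) a s * A u s].
have [B ltB] : exists B, forall u, (w u < B)%N.
  by exists (\max_u w u).+1 => u; rewrite ltnS leq_bigmax.
have iter_step d a b m u : (B <= w u + m)%N ->
    iter m (step d) a u = iter m (step d) b u.
  elim: m u => [|m IHm] u.
    by rewrite addn0 leqNgt ltB.
  move=> Bu; rewrite !iterS !ffunE; congr (_ - _); apply: eq_bigr => s su.
  have [->|Aus] := eqVneq (A u s) 0; first by rewrite !mulr0.
  rewrite IHm // (leq_trans Bu) // addnS -addSn leq_add2r.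
  exact: Alt.
have iter_const d a b : iter B (step d) a = iter B (step d) b.
  by apply/ffunP=> u; apply: iter_step; apply: leq_addl.
exists (fun d => iter B (step d) 0) => [a|d]; last first.
  have fix_g : step d (iter B (step d) 0) = iter B (step d) 0.
    by rewrite -iterS iterSr; apply: iter_const.
  apply/ffunP=> u; rewrite ffunE (bigD1 u) //= A1 mulr1 /=.
  by rewrite -{1}fix_g ffunE subrK.
rewrite (iter_const _ _ a).
apply: iter_fix; apply/ffunP=> u.
by rewrite !ffunE (bigD1 u) //= A1 mulr1 addrK.
Qed.

(** * Projectivity and direct sums *)

(** A linear map on the regular module is determined by the image of 1, so
    lifting it through a surjection only takes a preimage m of one element;
    the retract inherits the lift by composition with i. *)
Lemma projective_retract_regular (R : pzRingType) (P : lmodType R)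
    (i : {linear P -> R^o}) (p : {linear R^o -> P}) :
  cancel i p -> projective P.
Proof.
move=> ip M N g h gsurj.
have [m gm] := gsurj (h (p 1)).
have lin : linear (fun x : P => (i x : R) *: m).
  by move=> c x y; rewrite linearP scalerDl -scalerA.
pose mx := GRing.isLinear.Build _ _ _ _ _ lin.
pose h' : {linear P -> M} := HB.pack (fun x : P => (i x : R) *: m) mx.
exists h' => x; rewrite /= linearZ_LR gm -!linearZ_LR /=.
by rewrite -[in RHS](ip x); congr (h (p _)); exact: mulr1.
Qed.

Section DirectSumMaps.
Variables (R : pzRingType) (I : finType) (M : I -> lmodType R) (i : I).

Definition dsum_proj (u : dsum M) : M i := u i.

Fact dsum_proj_is_linear : linear dsum_proj.
Proof. by move=> a u v; rewrite /dsum_proj !ffunE. Qed.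
HB.instance Definition _ :=
  GRing.isLinear.Build R (dsum M) (M i) *:%R dsum_proj dsum_proj_is_linear.

Definition dsum_inj (x : M i) : dsum M :=
  [ffun j => dfwith (fun j => 0 : M j) x j].

Lemma dsum_injK : cancel dsum_inj dsum_proj.
Proof. by move=> x; rewrite /dsum_proj ffunE dfwith_in. Qed.

Fact dsum_inj_is_linear : linear dsum_inj.
Proof.
move=> a x y; apply/ffunP=> j; rewrite !ffunE.
have [<-|ij] := eqVneq i j; first by rewrite !dfwith_in.
by rewrite !dfwith_out // scaler0 addr0.
Qed.
HB.instance Definition _ :=
  GRing.isLinear.Build R (M i) (dsum M) *:%R dsum_inj dsum_inj_is_linear.

End DirectSumMaps.

Lemma projective_dsum_regular (R : pzRingType) (I : finType)
    (M : I -> lmodType R) (i : I) :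
  lmod_iso R^o (dsum M) -> projective (M i).
Proof.
case=> f [g fK gK].
have glin : linear g by apply: can2_linear fK gK.
pose gmx := GRing.isLinear.Build _ _ _ _ _ glin.
pose gl : {linear dsum M -> R^o} := HB.pack g gmx.
apply: (@projective_retract_regular _ _ (gl \o @dsum_inj _ _ M i)
                                        (@dsum_proj _ _ M i \o f)) => x.
by rewrite /= gK dsum_injK.
Qed.

(** * Kernel sets and rounding down *)

Section Floor.
Variable n : nat.
Local Notation OD := (OD n.+1).
Implicit Types (X : {set 'I_n.+1}) (s u : OD) (x y z : 'I_n.+1).

Lemma mem_P1 X : (X \in P1 n.+1) = (ord0 \in X).
Proof.
rewrite inE; apply/exists_inP/idP => [[x xX /eqP x0]|]; last by exists ord0.
by rewrite (_ : ord0 = x) //; apply: val_inj.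
Qed.

Lemma kernel_setP s x :
  reflect (forall y, val s y = val s x -> (x <= y)%N) (x \in kernel_set s).
Proof.
rewrite inE; apply: (iffP forallP) => H y; first by move/eqP/(implyP (H y)).
by apply/implyP=> /eqP/H.
Qed.

(** The default [ord0] keeps the map order-preserving for every X; it is a
    member of X in the case of interest. *)
Definition floor X z : 'I_n.+1 :=
  [arg max_(x > ord0 | (x == ord0) || (x \in X) && (x <= z)%N) val x].

Variant floor_spec X z : 'I_n.+1 -> Type :=
  FloorSpec x of (x == ord0) || (x \in X) & (x <= z)%N
    & (forall y, y \in X -> (y <= z)%N -> (y <= x)%N) : floor_spec X z x.

Lemma floorP X z : floor_spec X z (floor X z).
Proof.
rewrite /floor; case: arg_maxnP => // x xP xmax.
split; first by case/orP: xP => [->|/andP[->]]; rewrite ?orbT.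
- by case/orP: xP => [/eqP->|/andP[]].
- by move=> y yX yz; apply: xmax; rewrite yX yz orbT.
Qed.

Lemma floor_le X z : (floor X z <= z)%N. Proof. by case: floorP. Qed.

Lemma floor_mono X y z : (y <= z)%N -> (floor X y <= floor X z)%N.
Proof.
case: (floorP X y) => x /orP[/eqP-> //|xX] xy _ yz; case: floorP => t _ _.
by apply=> //; apply: leq_trans yz.
Qed.

Lemma floor_mem X z : ord0 \in X -> floor X z \in X.
Proof. by case: floorP => x /orP[/eqP->|]. Qed.

Lemma floor_id X x : x \in X -> floor X x = x.
Proof.
case: floorP => t _ tx tmax xX; apply/val_inj/eqP.
by rewrite eqn_leq tx tmax.
Qed.

Fact floor_OD_subproof X :
  order_preserving [ffun z => floor X z] || order_reversing [ffun z => floor X z].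
Proof.
apply/orP; left; apply/order_preservingP=> y z yz.
by rewrite !ffunE floor_mono.
Qed.

Definition floor_OD X : OD := Sub [ffun z => floor X z] (floor_OD_subproof X).

Lemma floor_ODE X z : val (floor_OD X) z = floor X z.
Proof. by rewrite ffunE. Qed.

Lemma kernel_set_floor X : ord0 \in X -> kernel_set (floor_OD X) = X.
Proof.
move=> X0; apply/setP=> x; apply/kernel_setP/idP => [xmin|xX y].
  rewrite (_ : x = floor X x) ?floor_mem //; apply/val_inj/eqP.
  rewrite eqn_leq floor_le andbT xmin // !floor_ODE floor_id //.
  exact: floor_mem.
by rewrite !floor_ODE (floor_id xX) => <-; apply: floor_le.
Qed.

(** The floor of z in the kernel set lies between the minimum of the fibre of
    z and z itself, and the two ends have the same image. *)
Lemma mul_floor_kernel s : (s * floor_OD (kernel_set s))%g = s.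
Proof.
apply/val_inj/ffunP=> z; rewrite OD_mulE floor_ODE.
pose m := [arg min_(y < z | val s y == val s z) val y].
have [msz mmin] : val s m = val s z /\
    forall y, val s y = val s z -> (m <= y)%N.
  by rewrite /m; case: arg_minnP => // x /eqP-> H; split=> // y /eqP/H.
have mK : m \in kernel_set s.
  by apply/kernel_setP=> y; rewrite msz => /mmin.
case: floorP => t _ tz /(_ m mK (mmin z erefl)) mt.
apply/val_inj/eqP; rewrite eqn_leq.
case/orP: (valP s) => [/order_preservingP|/order_reversingP] mono.
- by rewrite mono //= -msz mono.
- by rewrite andbC mono //= -msz mono.
Qed.

Definition prefix_image s y : {set 'I_n.+1} :=
  [set val s x | x : 'I_n.+1 in [pred x : 'I_n.+1 | (x <= y)%N]].

Definition prefix_weight s : nat := (\sum_y #|prefix_image s y|)%N.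

Lemma prefix_image_floor s X y :
  prefix_image (s * floor_OD X)%g y \subset prefix_image s y.
Proof.
apply/subsetP=> _ /imsetP[x xy ->]; rewrite OD_mulE floor_ODE.
by apply: imset_f; rewrite inE (leq_trans (floor_le X x)).
Qed.

(** A point is minimal in its fibre exactly when its value is absent from the
    image of the preceding initial segment, that is, when passing to it enlarges
    the image; so the growth of these images determines the kernel set. *)
Lemma kernel_set_prefix s u :
  prefix_image s =1 prefix_image u -> kernel_set s = kernel_set u.
Proof.
have card_prefix (t : OD) x (y : 'I_n.+1) : val x = (val y).+1 ->
    #|prefix_image t x| = ((x \in kernel_set t) + #|prefix_image t y|)%N.
  move=> xy.
  have -> : prefix_image t x = val t x |: prefix_image t y.
    apply/setP=> v; rewrite in_setU1; apply/imsetP/orP.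
      case=> z; rewrite inE leq_eqVlt => /orP[/eqP/val_inj-> ->|zx ->].
        by left.
      by right; apply: imset_f; rewrite inE -ltnS -xy.
    case=> [/eqP->|/imsetP[z zy ->]]; first by exists x; rewrite ?inE.
    by exists z; rewrite // inE xy (leq_trans zy).
  rewrite cardsU1; congr (nat_of_bool _ + _)%N.
  apply/negP/kernel_setP => [xt z tz|xmin /imsetP[z zy tz]].
    rewrite leqNgt; apply/negP=> zx; apply: xt.
    by rewrite -tz; apply: imset_f; rewrite inE -ltnS -xy.
  have := xmin z (esym tz); rewrite leqNgt => /negP; apply.
  by rewrite xy ltnS.
move=> su; apply/setP=> x.
case: x => [[|m] mn].
  by apply/kernel_setP/kernel_setP.
have := card_prefix s (Ordinal mn) (Ordinal (ltnW mn)) erefl.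
rewrite !su (card_prefix u (Ordinal mn) (Ordinal (ltnW mn)) erefl) => /addIn.
by do 2!case: (_ \in _).
Qed.

Lemma prefix_weight_lt s u :
  s != u -> u = (s * floor_OD (kernel_set u))%g ->
  (prefix_weight u < prefix_weight s)%N.
Proof.
move=> su uE.
have sub y : prefix_image u y \subset prefix_image s y.
  by rewrite [in X in X \subset _]uE prefix_image_floor.
have le y := subset_leqif_cards (sub y).
have le_sum := leqif_sum (fun y (_ : true) => le y).
rewrite ltn_neqAle /prefix_weight !le_sum andbT.
apply: contra su => /forallP eq_img.
rewrite uE (@kernel_set_prefix u s) ?mul_floor_kernel // => y.
exact/eqP/eq_img.
Qed.

End Floor.

(** * The isomorphism *)

Section Isomorphism.
Variables (k : fieldType) (n : nat).

Local Notation P1_type := {X : {set 'I_n.+1} | X \in P1 n.+1}.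
Local Notation target := (dsum (fun X : P1_type => kL k (val X))).

Fact floor_L_subproof (X : P1_type) :
  kernel_set (floor_OD (val X)) == val X.
Proof. by rewrite kernel_set_floor // -mem_P1 (valP X). Qed.

Definition floor_L (X : P1_type) : L (val X) :=
  Sub (floor_OD (val X)) (floor_L_subproof X).

Definition act_floor (a : (ODalg k n.+1)^o) : target :=
  [ffun X => (a : ODalg k n.+1) *: kL_basis k (floor_L X)].

Fact act_floor_is_linear : linear act_floor.
Proof. by move=> c a b; apply/ffunP=> X; rewrite !ffunE scalerDl scalerA. Qed.
HB.instance Definition _ :=
  GRing.isLinear.Build (ODalg k n.+1) (ODalg k n.+1)^o target *:%R
    act_floor act_floor_is_linear.

Definition kernel_P1 (u : OD n.+1) : P1_type :=
  Sub (kernel_set u) (kernel_set_P1 u isT).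

(** The coefficients of an element of the direct sum on OD_n, the disjoint
    union of the sets L_X. *)
Definition coords (d : target) : {ffun OD n.+1 -> k} :=
  [ffun u => d (kernel_P1 u) (Sub u (eqxx (kernel_set u)))].

Lemma coords_inj : injective coords.
Proof.
move=> d d' /ffunP dd'; apply/ffunP=> -[X XP1]; apply/ffunP=> -[u uX] /=.
have XE : kernel_set u = X := eqP uX; subst X.
have := dd' u; rewrite !ffunE.
by rewrite /kernel_P1 (bool_irrelevance XP1 (kernel_set_P1 u isT))
  (bool_irrelevance uX (eqxx _)).
Qed.

Lemma coords_act_floor (a : ODalg k n.+1) :
  coords (act_floor a) =
  [ffun u => \sum_s a s * (u == s * floor_OD (kernel_set u))%g%:R].
Proof.
apply/ffunP=> u; rewrite !ffunE kL_actE; apply: eq_bigr => s _.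
rewrite (bigD1 (floor_L (kernel_P1 u))) //= ffunE eqxx mulr1 big1 ?addr0 //.
by move=> x /negbTE xf; rewrite ffunE xf mulr0 mul0r.
Qed.

Lemma act_floor_bij : bijective act_floor.
Proof.
pose A (u s : OD n.+1) : k := (u == s * floor_OD (kernel_set u))%g%:R.
have A1 u : A u u = 1 by rewrite /A mul_floor_kernel eqxx.
have Alt u s : s != u -> A u s != 0 -> (prefix_weight u < prefix_weight s)%N.
  rewrite /A; case: (_ =P (s * _)%g) => [uE su _|_ _]; last by rewrite eqxx.
  exact: prefix_weight_lt su uE.
have [g gK Kg] := unitriangular_bij A1 Alt.
exists (g \o coords) => [a|d] /=; first by rewrite coords_act_floor gK.
by apply: coords_inj; rewrite coords_act_floor Kg.
Qed.

End Isomorphism.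

Theorem proposition3p3 (n : nat) (hn : (1 <= n)%N) (k : fieldType) :
  (forall X : {set 'I_n}, X \in P1 n -> projective (kL k X)) /\
  lmod_iso ((ODalg k n)^o)
           (dsum (fun X : {X : {set 'I_n} | X \in P1 n} => kL k (val X))).
Proof.
case: n hn => // n _.
have iso : lmod_iso ((ODalg k n.+1)^o)
    (dsum (fun X : {X : {set 'I_n.+1} | X \in P1 n.+1} => kL k (val X))).
  by exists (@act_floor k n); apply: act_floor_bij.
split=> // X XP1.
exact: projective_dsum_regular (exist _ X XP1) iso.
Qed.
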